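(* Let $m\ge 1$ be an integer, and let $\mathbf F,\mathbf P,\mathbf S_1,\mathbf S_2,\mathbf H$, $\langle\cdot,\cdot\rangle_h$, $M_h$, $E_h$ be the discretization matrices, discrete inner product, semi-discrete mass and semi-discrete energy defined in the context. (1) The following spatial semi-discretization of the generalized Benjamin-Ono equation $$\mathbf{u}_t=-\mathbf{P}^{-1}\mathbf{F}^{-1}\mathbf{S}_1\mathbf{F}\mathbf{P}\Big(-\mathbf{P}^{-1}\mathbf{F}^{-1}\mathbf{H}\mathbf{S}_1\mathbf{F}\mathbf{P}\,\mathbf{u}+\frac1m\mathbf{u}^{\mathbf m}\Big)$$ conserves the spatial semi-discretized energy: every real solution $\mathbf u(t)$ satisfies $\frac{d}{dt}E_h=0$. (2) The following spatial semi-discretization of the generalized Benjamin-Ono equation $$\mathbf{u}_t=\mathbf{P}^{-1}\mathbf{F}^{-1}\mathbf{H}\mathbf{S}_2\mathbf{F}\mathbf{P}\,\mathbf{u}-\frac{1}{m+1}\Big(\mathrm{diag}(\mathbf{u}^{\mathbf{m-1}})\,\mathbf{P}^{-1}\mathbf{F}^{-1}\mathbf{S}_1\mathbf{F}\mathbf{P}\,\mathbf{u}+\mathbf{P}^{-1}\mathbf{F}^{-1}\mathbf{S}_1\mathbf{F}\mathbf{P}\,\mathbf{u}^{\mathbf m}\Big)$$ conserves the spatial semi-discretized mass: every real solution $\mathbf u(t)$ satisfies $\frac{d}{dt}M_h=0$.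
   Context: The generalized Benjamin-Ono equation is $u_t=-(-\mathcal H u_x+\frac1m u^m)_x$ on $\mathbb R$, $u$ real-valued, $\mathcal H$ the Hilbert transform with $\widehat{\mathcal H f}(\xi)=-i\,\mathrm{sgn}(\xi)\hat f(\xi)$. Discretization. Let $\alpha>0$, $N$ a positive even integer, $J=\{-N/2,\dots,N/2-1\}$; vectors and matrices are indexed by $J$. Put $\theta_j=2\pi j/N$, $x_j=\alpha\tan(\theta_j/2)$, so $x_{-N/2}=-\infty$. Define: - $\mathbf F_{kj}=\frac1N e^{-ik\theta_j}$ and $(\mathbf F^{-1})_{jk}=e^{ik\theta_j}$ (discrete Fourier matrix and its inverse); - $\mathbf P=\mathrm{diag}(\alpha-ix_j)_{j\in J}$ and $\mathbf W=\mathbf P\overline{\mathbf P}=\mathrm{diag}(w_j)$, $w_j=\alpha^2+x_j^2$; - $\mathbf S_1$ the tridiagonal matrix $(\mathbf S_1\hat{\mathbf u})_k=\frac{i}{2\alpha}\big[k\hat u_{k-1}+(2k+1)\hat u_k+(k+1)\hat u_{k+1}\big]$, where $\hat u_{k}:=0$ for $k\notin J$; $\mathbf S_2=\mathbf S_1\mathbf S_1$; - $\mathbf H=-i\,\mathrm{diag}(\mathrm{sgn}(k+\tfrac12))_{k\in J}$. Boundary convention at the node $x_{-N/2}=-\infty$: all grid vectors $\mathbf u=(u_j)_{j\in J}$ satisfy $u_{-N/2}=0$, and this node contributes nothing; i.e. the $-N/2$ diagonal entries of $\mathbf P$, $\mathbf P^{-1}$ and $\mathbf W$ are read as $0$ (the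 other diagonal entries of $\mathbf P^{-1}$ are $1/(\alpha-ix_j)$). The discrete inner product is $\langle\mathbf u,\mathbf v\rangle_h=\frac{\pi}{N\alpha}\overline{\mathbf v}^T\mathbf W\mathbf u=\frac{\pi}{N\alpha}\sum_{j\in J} w_ju_j\bar v_j$. Powers $\mathbf u^{\mathbf p}=(u_j^p)_j$ are entrywise, and $\mathrm{diag}(\mathbf v)$ is the diagonal matrix with diagonal $\mathbf v$. Semi-discrete mass and energy: $$M_h=\langle\mathbf u,\mathbf u\rangle_h,\qquad E_h=\tfrac12\langle\mathbf P^{-1}\mathbf F^{-1}\mathbf H\mathbf S_1\mathbf F\mathbf P\mathbf u,\mathbf u\rangle_h-\tfrac1{m(m+1)}\langle\mathbf u^{\mathbf m},\mathbf u\rangle_h.$$ A real solution is a differentiable function $t\mapsto\mathbf u(t)\in\mathbb R^N$ on a time interval, with $u_{-N/2}(t)=0$, satisfying the stated ODE system. *)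

(* Defs.v *)
From mathcomp Require Import all_boot all_order all_algebra.
From mathcomp Require Import complex.
From mathcomp Require Import all_classical all_reals all_analysis.

Set Implicit Arguments.
Unset Strict Implicit.
Unset Printing Implicit Defensive.

Import Order.TTheory GRing.Theory Num.Theory.
Import numFieldNormedType.Exports.

Local Open Scope classical_set_scope.
Local Open Scope ring_scope.
Local Open Scope complex_scope.

(* The index set J = {-N/2, ..., N/2 - 1} is represented by 'I_N: the ordinal j
   stands for the integer j - N/2, so that ordinal 0 is the node x_{-N/2}. *)
Definition idx (N : nat) (j : 'I_N) : int := j%:Z - (N./2)%:Z.

Definition at_infty (N : nat) (j : 'I_N) : bool := idx j == - (N./2)%:Z.

Definition theta (R : realType) (N : nat) (j : 'I_N) : R :=
  2 * pi * (idx j)%:~R / N%:R.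

(* At the node at infinity the tangent has a junk value, which [Pmx], [Pinvmx]
   and [Wmx] never use. *)
Definition xnode (R : realType) (N : nat) (alpha : R) (j : 'I_N) : R :=
  alpha * tan (theta R j / 2).

(* e^{i x} *)
Definition expi (R : realType) (x : R) : R[i] := cos x +i* sin x.

Definition Fmx (R : realType) (N : nat) : 'M[R[i]]_N :=
  \matrix_(k, j) (N%:R^-1 * expi (- ((idx k)%:~R * theta R j))).

Definition Finvmx (R : realType) (N : nat) : 'M[R[i]]_N :=
  \matrix_(j, k) expi ((idx k)%:~R * theta R j).

(* [Pinvmx] is the inverse of [Pmx] only away from the node at infinity, where
   both have a zero entry by convention. *)
Definition Pmx (R : realType) (N : nat) (alpha : R) : 'M[R[i]]_N :=
  diag_mx (\row_j if at_infty j then 0 else alpha -i* xnode alpha j).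

Definition Pinvmx (R : realType) (N : nat) (alpha : R) : 'M[R[i]]_N :=
  diag_mx (\row_j if at_infty j then 0 else (alpha -i* xnode alpha j)^-1).

Definition Wmx (R : realType) (N : nat) (alpha : R) : 'M[R[i]]_N :=
  diag_mx (\row_j if at_infty j then 0
                  else (alpha ^+ 2 + xnode alpha j ^+ 2)%:C).

Definition S1mx (R : realType) (N : nat) (alpha : R) : 'M[R[i]]_N :=
  \matrix_(k, l)
    ((0 +i* 1) / (2 * alpha)%:C *
     (if idx l == idx k - 1 then (idx k)%:~R
      else if idx l == idx k then (2 * idx k + 1)%:~R
      else if idx l == idx k + 1 then (idx k + 1)%:~R
      else 0)).

Definition S2mx (R : realType) (N : nat) (alpha : R) : 'M[R[i]]_N :=
  S1mx N alpha *m S1mx N alpha.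

Definition Hmx (R : realType) (N : nat) : 'M[R[i]]_N :=
  diag_mx (\row_k (- (0 +i* 1) * (Num.sg ((idx k)%:~R + 2^-1 : R))%:C)).

(* P^{-1} F^{-1} A F P *)
Definition conjPF (R : realType) (N : nat) (alpha : R) (A : 'M[R[i]]_N) :
    'M[R[i]]_N :=
  Pinvmx N alpha *m Finvmx R N *m A *m Fmx R N *m Pmx N alpha.

Definition innerh (R : realType) (N : nat) (alpha : R) (u v : 'cV[R[i]]_N) :
    R[i] :=
  (pi / (N%:R * alpha))%:C * ((map_mx conjc v)^T *m Wmx N alpha *m u) ord0 ord0.

Definition powv (R : realType) (N : nat) (u : 'cV[R[i]]_N) (p : nat) :
    'cV[R[i]]_N :=
  map_mx (fun z => z ^+ p) u.

Definition Mh (R : realType) (N : nat) (alpha : R) (u : 'cV[R[i]]_N) : R[i] :=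
  innerh alpha u u.

Definition Eh (R : realType) (N m : nat) (alpha : R) (u : 'cV[R[i]]_N) : R[i] :=
  2^-1 * innerh alpha (conjPF alpha (Hmx R N *m S1mx N alpha) *m u) u
  - (m * m.+1)%N%:R^-1 * innerh alpha (powv u m) u.

Definition rhs_energy (R : realType) (N m : nat) (alpha : R)
    (u : 'cV[R[i]]_N) : 'cV[R[i]]_N :=
  - (conjPF alpha (S1mx N alpha) *m
     (- (conjPF alpha (Hmx R N *m S1mx N alpha) *m u) + m%:R^-1 *: powv u m)).

Definition rhs_mass (R : realType) (N m : nat) (alpha : R)
    (u : 'cV[R[i]]_N) : 'cV[R[i]]_N :=
  conjPF alpha (Hmx R N *m S2mx N alpha) *m u
  - m.+1%:R^-1 *:
    (diag_mx (powv u m.-1)^T *m (conjPF alpha (S1mx N alpha) *m u)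
     + conjPF alpha (S1mx N alpha) *m powv u m).

(* Derivative relative to the interval I: two-sided at interior points and
   one-sided at the endpoints that belong to I. *)
Definition has_deriv (R : realType) (I : interval R) (f : R -> R) (t l : R) :
    Prop :=
  (f s - f t) / (s - t) @[s --> within [set` I] t^'] --> l.

Definition has_cderiv (R : realType) (I : interval R) (f : R -> R[i]) (t : R)
    (l : R[i]) : Prop :=
  has_deriv I (fun s => complex.Re (f s)) t (complex.Re l) /\
  has_deriv I (fun s => complex.Im (f s)) t (complex.Im l).

Definition cvec (R : realType) (N : nat) (u : 'cV[R]_N) : 'cV[R[i]]_N :=
  map_mx (fun x : R => x%:C) u.

Definition real_solution (R : realType) (N : nat)
    (rhs : 'cV[R[i]]_N -> 'cV[R[i]]_N) (I : interval R) (u : R -> 'cV[R]_N) :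
    Prop :=
  forall t : R, t \in I ->
    (forall j : 'I_N, at_infty j -> u t j ord0 = 0) /\
    exists du : 'cV[R]_N,
      (forall j : 'I_N, has_deriv I (fun s => u s j ord0) t (du j ord0)) /\
      cvec du = rhs (cvec (u t)).

(* Main.v *)
Require Import Defs.
From mathcomp Require Import all_boot all_order all_algebra.
From mathcomp Require Import ring lra zify.
From mathcomp Require Import complex.
From mathcomp Require Import all_classical all_reals all_analysis.
Import Order.TTheory GRing.Theory Num.Theory.
Import numFieldNormedType.Exports.
Local Open Scope ring_scope.

(** Write <u, v> for the discrete inner product and [M] for the matrix
    P^-1 F^-1 M F P.  Since F^-1 is N times the adjoint F^* of F, and the weight
    satisfies W P^-1 = P^* (both sides vanish at the node at infinity),
      W [M] = N (F P)^* M (F P),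
    so the adjoint of [M] for <., .> is [M^*] ([innerh_adjoint]).  The symmetry of
    the discrete operators is thus read off in frequency space.  S1 is i times a
    real symmetric matrix, hence skew-adjoint; H is diagonal and imaginary, hence
    skew-adjoint.  They commute because the only entries of S1 linking a negative
    frequency to a nonnegative one, between -1 and 0, have coefficient 0.
    Therefore [H S1] is self-adjoint, while [S1] and [H S2] are skew-adjoint.

    Energy: put A = [H S1], D = [S1] and g = A u - u^m / m.  The equation is
    u' = D g, and differentiating E_h gives
      Re <A u, u'> - <u^m, u'> / m = Re <g, u'> = Re <g, D g> = 0;
    self-adjointness of A and the reality of u and u' give the first expression.

    Mass: the derivative of M_h is 2 Re <u', u>.  The linear term contributes
    nothing because [H S2] is skew-adjoint.  As u is real, the nonlinear terms
    contribute <diag(u^(m-1)) D u, u> + <D u^m, u> = <D u, u^m> - <u^m, D u>,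
    a difference of two conjugates, so its real part is zero. *)

(** * Calculus of derivatives relative to an interval *)

Lemma within_dnbhs_filter {R : realType} (I : interval R) (t : R) :
  Filter (within [set` I] t^'%classic).
Proof. exact: within_filter. Qed.

Lemma has_deriv_cvg {R : realType} (I : interval R) (f : R -> R) (t l : R) :
  has_deriv I f t l -> (f s @[s --> within [set` I] t^'] --> f t)%classic.
Proof.
move=> df; have FF := within_dnbhs_filter I t.
have dt : ((s - t) @[s --> within [set` I] t^'] --> (0 : R))%classic.
  have idt : (s @[s --> within [set` I] t^'] --> t)%classic.
    by apply: cvg_within_filter; exact: (@nbhs_dnbhs R t).
  by have := cvgB (FF := FF) idt (cvg_cst t (FF := FF)); rewrite subrr; exact.
(* Off t, f s is the difference quotient times s - t, plus f t. *)
have := cvgD (FF := FF) (cvgM (FF := FF) df dt) (cvg_cst (f t) (FF := FF)).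
rewrite mulr0 add0r.
apply: cvg_trans; apply: near_eq_cvg; rewrite near_withinE.
near=> s => _ /=.
have st : s - t != 0 by rewrite subr_eq0; near: s; exact: nbhs_dnbhs_neq.
by rewrite /= !fctE /=; field.
Unshelve. all: by end_near. Qed.

(** Brings a difference quotient into the form that the limit rules produce. *)
Lemma has_deriv_eq {R : realType} (I : interval R) (f h : R -> R) (t l : R) :
  (h s @[s --> within [set` I] t^'] --> l)%classic ->
  (forall s, (f s - f t) / (s - t) = h s) -> has_deriv I f t l.
Proof. by move=> hl fh; rewrite /has_deriv; under eq_fun do rewrite fh. Qed.

Lemma has_deriv_cst {R : realType} (I : interval R) (c t : R) :
  has_deriv I (fun=> c) t 0.
Proof.
rewrite /has_deriv; under eq_fun do rewrite subrr mul0r.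
exact: (cvg_cst _ (FF := within_dnbhs_filter I t)).
Qed.

Lemma has_derivN {R : realType} (I : interval R) (f : R -> R) (t l : R) :
  has_deriv I f t l -> has_deriv I (fun s => - f s) t (- l).
Proof.
move=> df; have FF := within_dnbhs_filter I t.
have /has_deriv_eq := cvgN (FF := FF) df; apply=> s.
by rewrite ?fctE /=; ring.
Qed.

Lemma has_derivD {R : realType} (I : interval R) (f g : R -> R) (t l k : R) :
  has_deriv I f t l -> has_deriv I g t k ->
  has_deriv I (fun s => f s + g s) t (l + k).
Proof.
move=> df dg; have FF := within_dnbhs_filter I t.
have /has_deriv_eq := cvgD (FF := FF) df dg; apply=> s.
by rewrite ?fctE /=; ring.
Qed.

Lemma has_derivM {R : realType} (I : interval R) (f g : R -> R) (t l k : R) :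
  has_deriv I f t l -> has_deriv I g t k ->
  has_deriv I (fun s => f s * g s) t (l * g t + f t * k).
Proof.
move=> df dg; have FF := within_dnbhs_filter I t.
have /has_deriv_eq := cvgD (FF := FF)
  (cvgM (FF := FF) df (cvg_cst (g t) (FF := FF)))
  (cvgM (FF := FF) (has_deriv_cvg I f t l df) dg).
by apply=> s; rewrite ?fctE /=; ring.
Qed.

Lemma has_cderiv_real {R : realType} (I : interval R) (f : R -> R) (t l : R) :
  has_deriv I f t l -> has_cderiv I (fun s => (f s)%:C%C) t l%:C%C.
Proof. by split=> //=; exact: has_deriv_cst. Qed.

Lemma has_cderiv_cst {R : realType} (I : interval R) (c : R[i]%C) (t : R) :
  has_cderiv I (fun=> c) t 0.
Proof. by split; exact: has_deriv_cst. Qed.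

Lemma has_cderivJ {R : realType} (I : interval R) f t (l : R[i]%C) :
  has_cderiv I f t l -> has_cderiv I (fun s => (f s)^*%C) t l^*%C.
Proof.
have ReJ (z : R[i]%C) : complex.Re z^*%C = complex.Re z by case: z.
have ImJ (z : R[i]%C) : complex.Im z^*%C = - complex.Im z by case: z.
move=> [dRe dIm]; split; first by under eq_fun do rewrite ReJ; rewrite ReJ.
by under eq_fun do rewrite ImJ; rewrite ImJ; exact: has_derivN.
Qed.

Lemma has_cderivD {R : realType} (I : interval R) f g t (l k : R[i]%C) :
  has_cderiv I f t l -> has_cderiv I g t k ->
  has_cderiv I (fun s => f s + g s) t (l + k).
Proof.
move=> [f1 f2] [g1 g2]; split; rewrite raddfD.
  by under eq_fun do rewrite raddfD; exact: has_derivD.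
by under eq_fun do rewrite raddfD; exact: has_derivD.
Qed.

Lemma has_cderivM {R : realType} (I : interval R) f g t (l k : R[i]%C) :
  has_cderiv I f t l -> has_cderiv I g t k ->
  has_cderiv I (fun s => f s * g s) t (l * g t + f t * k).
Proof.
move=> [f1 f2] [g1 g2].
have ReM (x y : R[i]%C) : complex.Re (x * y) =
    complex.Re x * complex.Re y + - (complex.Im x * complex.Im y).
  by case: x y => [? ?] [? ?].
have ImM (x y : R[i]%C) : complex.Im (x * y) =
    complex.Re x * complex.Im y + complex.Im x * complex.Re y.
  by case: x y => [? ?] [? ?].
have ReD (x y : R[i]%C) : complex.Re (x + y) = complex.Re x + complex.Re y.
  exact: raddfD.
have ImD (x y : R[i]%C) : complex.Im (x + y) = complex.Im x + complex.Im y.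
  exact: raddfD.
split.
  under eq_fun do rewrite ReM.
  have := has_derivD _ _ _ _ _ _ (has_derivM _ _ _ _ _ _ f1 g1)
            (has_derivN _ _ _ _ (has_derivM _ _ _ _ _ _ f2 g2)).
  by congr has_deriv; rewrite ReD !ReM; ring.
under eq_fun do rewrite ImM.
have := has_derivD _ _ _ _ _ _ (has_derivM _ _ _ _ _ _ f1 g2)
          (has_derivM _ _ _ _ _ _ f2 g1).
by congr has_deriv; rewrite ImD !ImM; ring.
Qed.

Lemma has_cderivX {R : realType} (I : interval R) f t (l : R[i]%C) (n : nat) :
  has_cderiv I f t l ->
  has_cderiv I (fun s => f s ^+ n) t (n%:R * f t ^+ n.-1 * l).
Proof.
move=> df; elim: n => [|n IH].
  by under eq_fun do rewrite expr0; rewrite !mul0r; exact: has_cderiv_cst.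
under eq_fun do rewrite exprS.
have := has_cderivM _ _ _ _ _ _ df IH; congr has_cderiv.
by case: n {IH} => [|n] /=; rewrite ?exprS ?expr0; ring.
Qed.

Lemma has_cderiv_sum {R : realType} (I : interval R) (T : finType)
    (f : T -> R -> R[i]%C) t (l : T -> R[i]%C) :
  (forall j, has_cderiv I (f j) t (l j)) ->
  has_cderiv I (fun s => \sum_j f j s) t (\sum_j l j).
Proof.
move=> df; elim: (index_enum T) => [|j r IH].
  by under eq_fun do rewrite big_nil; rewrite big_nil; exact: has_cderiv_cst.
under eq_fun do rewrite big_cons.
by rewrite big_cons; exact: has_cderivD.
Qed.

(** * Differentiating vectors and the discrete inner product *)

Definition has_vderiv {R : realType} {N : nat} (I : interval R)
    (v : R -> 'cV[R[i]%C]_N) (t : R) (dv : 'cV[R[i]%C]_N) : Prop :=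
  forall j, has_cderiv I (fun s => v s j ord0) t (dv j ord0).

Lemma has_vderiv_mulmx {R : realType} {N : nat} (I : interval R) v t dv
    (A : 'M[R[i]%C]_N) :
  has_vderiv I v t dv -> has_vderiv I (fun s => A *m v s) t (A *m dv).
Proof.
move=> dvP j; under eq_fun do rewrite mxE.
rewrite mxE; apply: has_cderiv_sum => k.
have := has_cderivM _ _ _ _ _ _ (has_cderiv_cst I (A j k) t) (dvP k).
by rewrite mul0r add0r.
Qed.

Lemma innerhE {R : realType} {N : nat} (alpha : R) (u v : 'cV[R[i]%C]_N) :
  innerh alpha u v =
  \sum_j (pi / (N%:R * alpha))%:C%C * Wmx N alpha j j
         * (u j ord0 * (v j ord0)^*%C).
Proof.
rewrite /innerh mxE mulr_sumr; apply: eq_bigr => j _.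
by rewrite /Wmx mul_mx_diag !mxE eqxx mulr1n; ring.
Qed.

Lemma has_cderiv_innerh {R : realType} {N : nat} (alpha : R) (I : interval R)
    (v w : R -> 'cV[R[i]%C]_N) t dv dw :
  has_vderiv I v t dv -> has_vderiv I w t dw ->
  has_cderiv I (fun s => innerh alpha (v s) (w s)) t
    (innerh alpha dv (w t) + innerh alpha (v t) dw).
Proof.
move=> dvP dwP; under eq_fun do rewrite innerhE.
rewrite !innerhE -big_split; apply: has_cderiv_sum => j /=.
have := has_cderivM _ _ _ _ _ _ (has_cderiv_cst I
   ((pi / (N%:R * alpha))%:C%C * Wmx N alpha j j) t)
   (has_cderivM _ _ _ _ _ _ (dvP j) (has_cderivJ _ _ _ _ (dwP j))).
by rewrite mul0r add0r mulrDr.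
Qed.

(** * Sesquilinearity of the discrete inner product *)

Lemma conjcM {R : rcfType} (x y : R[i]%C) : (x * y)^*%C = x^*%C * y^*%C.
Proof. exact: rmorphM. Qed.

Lemma conjcB {R : rcfType} (x y : R[i]%C) : (x - y)^*%C = x^*%C - y^*%C.
Proof. exact: rmorphB. Qed.

Lemma innerhDl {R : realType} {N : nat} (alpha : R) (u v w : 'cV[R[i]%C]_N) :
  innerh alpha (u + v) w = innerh alpha u w + innerh alpha v w.
Proof. by rewrite /innerh mulmxDr mxE mulrDr. Qed.

Lemma innerhNl {R : realType} {N : nat} (alpha : R) (u w : 'cV[R[i]%C]_N) :
  innerh alpha (- u) w = - innerh alpha u w.
Proof. by rewrite /innerh mulmxN mxE mulrN. Qed.

Lemma innerhZl {R : realType} {N : nat} (alpha : R) a (u w : 'cV[R[i]%C]_N) :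
  innerh alpha (a *: u) w = a * innerh alpha u w.
Proof. by rewrite /innerh -scalemxAr mxE mulrCA. Qed.

(** The inner product is Hermitian because the weights are real. *)
Lemma innerhC {R : realType} {N : nat} (alpha : R) (u v : 'cV[R[i]%C]_N) :
  (innerh alpha u v)^*%C = innerh alpha v u.
Proof.
rewrite !innerhE rmorph_sum; apply: eq_bigr => j _ /=.
have WJ : (Wmx N alpha j j)^*%C = Wmx N alpha j j.
  by rewrite /Wmx !mxE eqxx mulr1n; case: ifP => _; rewrite ?conjc0 ?conjc_real.
by rewrite !conjcM conjc_real WJ conjcK; ring.
Qed.

Lemma innerhNr {R : realType} {N : nat} (alpha : R) (u w : 'cV[R[i]%C]_N) :
  innerh alpha u (- w) = - innerh alpha u w.
Proof. by rewrite -innerhC innerhNl rmorphN /= innerhC. Qed.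

(** * Adjoints of the discrete operators *)

Definition adjmx {R : realType} {m n : nat} (A : 'M[R[i]%C]_(m, n)) :
  'M[R[i]%C]_(n, m) := (map_mx (@conjc R) A)^T.

Lemma adjmxM {R : realType} {m n p : nat} (A : 'M[R[i]%C]_(m, n))
  (B : 'M[R[i]%C]_(n, p)) : adjmx (A *m B) = adjmx B *m adjmx A.
Proof. by rewrite /adjmx map_mxM trmx_mul. Qed.

Lemma adjmxK {R : realType} {m n : nat} (A : 'M[R[i]%C]_(m, n)) :
  adjmx (adjmx A) = A.
Proof. by apply/matrixP => i j; rewrite !mxE conjcK. Qed.

Lemma adjmx_diag {R : realType} {n : nat} (d : 'rV[R[i]%C]_n) :
  adjmx (diag_mx d) = diag_mx (map_mx (@conjc R) d).
Proof. by rewrite /adjmx map_diag_mx tr_diag_mx. Qed.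

Lemma Finvmx_adj {R : realType} {N : nat} :
  (0 < N)%N -> Finvmx R N = N%:R *: adjmx (Fmx R N).
Proof.
move=> N0; apply/matrixP => j k; rewrite !mxE conjcM conjc_inv conjc_nat.
rewrite mulVKf ?pnatr_eq0 -?lt0n//.
by rewrite /expi /= cosN sinN opprK.
Qed.

(** Away from infinity this is w_j = |alpha - i x_j|^2; at infinity the
    convention sets both sides to 0, so no exceptional term survives. *)
Lemma Wmx_Pinvmx {R : realType} {N : nat} (alpha : R) : 0 < alpha ->
  Wmx N alpha *m Pinvmx N alpha = adjmx (Pmx N alpha).
Proof.
move=> a0; rewrite adjmx_diag /Wmx /Pinvmx mulmx_diag; congr diag_mx.
apply/rowP => j; rewrite !mxE; case: ifP => _; first by rewrite mul0r conjc0.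
set x := xnode alpha j.
have nz : (alpha -i* x)%C != 0.
  by rewrite eq_complex /= negb_and gt_eqF.
apply: (mulIf nz); rewrite divfK//; apply/eqP; rewrite eq_complex /=.
by apply/andP; split; apply/eqP; rewrite ?expr2; ring.
Qed.

(** The weight turns the conjugation by F P into a congruence by F P, which is
    what makes the adjoint of the conjugated matrix computable. *)
Lemma Wmx_conjPF {R : realType} {N : nat} (alpha : R) (M : 'M[R[i]%C]_N) :
  0 < alpha -> (0 < N)%N ->
  Wmx N alpha *m conjPF alpha M =
  N%:R *: (adjmx (Fmx R N *m Pmx N alpha) *m M *m (Fmx R N *m Pmx N alpha)).
Proof.
move=> a0 N0; rewrite /conjPF !mulmxA Wmx_Pinvmx// Finvmx_adj// adjmxM.
by rewrite -scalemxAr -!scalemxAl.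
Qed.

(** Reduces every symmetry in physical space to the same symmetry of the
    frequency matrix M, although F P itself is singular. *)
Lemma innerh_adjoint {R : realType} {N : nat} (alpha : R) (M : 'M[R[i]%C]_N)
    (u v : 'cV[R[i]%C]_N) : 0 < alpha -> (0 < N)%N ->
  innerh alpha (conjPF alpha M *m u) v =
  innerh alpha u (conjPF alpha (adjmx M) *m v).
Proof.
move=> a0 N0.
have innerE (x y : 'cV[R[i]%C]_N) : innerh alpha x y =
  (pi / (N%:R * alpha))%:C%C * (adjmx y *m Wmx N alpha *m x) ord0 ord0 by [].
have WJ : adjmx (Wmx N alpha) = Wmx N alpha.
  rewrite adjmx_diag; congr diag_mx; apply/rowP => j; rewrite !mxE.
  by case: ifP => _; rewrite ?conjc0 ?conjc_real.
have WM : Wmx N alpha *m conjPF alpha M =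
    adjmx (conjPF alpha (adjmx M)) *m Wmx N alpha.
  (* Both sides are N (F P)^* M (F P), read off from M and from its adjoint. *)
  rewrite -[in RHS]WJ -adjmxM !Wmx_conjPF// /adjmx map_mxZ linearZ /= conjc_nat.
  by rewrite -!/(adjmx _) !adjmxM !adjmxK !mulmxA.
rewrite !innerE adjmxM.
move: (conjPF alpha M) (conjPF alpha (adjmx M)) WM => K L WM.
by rewrite -!mulmxA [Wmx N alpha *m (K *m u)]mulmxA WM !mulmxA.
Qed.

Lemma conjPFN {R : realType} {N : nat} (alpha : R) (M : 'M[R[i]%C]_N) :
  conjPF alpha (- M) = - conjPF alpha M.
Proof. by rewrite /conjPF mulmxN !mulNmx. Qed.

(** In units of i / (2 alpha), the entries (k, k - 1) and (k - 1, k) are both k,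
    so S1 is i times a real symmetric matrix. *)
Lemma adjmx_S1mx {R : realType} {N : nat} (alpha : R) :
  adjmx (S1mx N alpha) = - S1mx N alpha.
Proof.
apply/matrixP => k l; rewrite !mxE /=.
have cJ : ((0 +i* 1) / (2 * alpha)%:C)%C^*%C
    = - ((0 +i* 1) / (2 * alpha)%:C)%C :> R[i]%C.
  rewrite conjcM conjc_inv conjc_real -mulNr; congr (_ * _).
  by apply/eqP; rewrite eq_complex /= oppr0 !eqxx.
have iJ (z : int) : (z%:~R : R[i]%C)^*%C = z%:~R by exact: rmorph_int.
rewrite conjcM cJ mulNr; congr (- (_ * _)).
(* Symmetry of the real band matrix, one diagonal at a time. *)
have [e1|n1] := eqVneq (idx k) (idx l - 1).
  have -> : (idx l == idx k - 1) = false by lia.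
  have -> : (idx l == idx k) = false by lia.
  have -> : idx l == idx k + 1 by lia.
  by rewrite iJ; congr (_%:~R); lia.
have [e2|n2] := eqVneq (idx k) (idx l).
  by rewrite !e2 ?eqxx iJ; have -> : (idx l == idx l - 1) = false by lia.
have [e3|n3] := eqVneq (idx k) (idx l + 1).
  have -> : idx l == idx k - 1 by lia.
  by rewrite iJ e3.
have -> : (idx l == idx k - 1) = false by lia.
have -> : (idx l == idx k + 1) = false by lia.
exact: conjc0.
Qed.

Lemma adjmx_Hmx {R : realType} {N : nat} : adjmx (Hmx R N) = - Hmx R N.
Proof.
rewrite /Hmx adjmx_diag -linearN; congr diag_mx.
apply/rowP => k; rewrite !mxE; apply/eqP; rewrite eq_complex /=.
by apply/andP; split; apply/eqP; ring.
Qed.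

(** The shift by 1/2 makes the sign at frequency 0 equal to 1 and leaves all the
    other signs unchanged. *)
Lemma sgr_half {R : realType} (k : int) :
  Num.sg (k%:~R + 2^-1 : R) = if 0 <= k then 1 else -1.
Proof.
case: ifPn => k0.
  by rewrite gtr0_sg// ltr_wpDl ?ler0z ?invr_gt0.
rewrite ltr0_sg//.
have : (k + 1)%:~R <= (0 : R) by rewrite lerz0; lia.
by rewrite intrD; lra.
Qed.

(** Commutation could only fail at entries that link frequencies of different
    sign; by tridiagonality these link -1 and 0, where the off-diagonal
    coefficients k (at k = 0) and k + 1 (at k = -1) vanish. *)
Lemma Hmx_S1mxC {R : realType} {N : nat} (alpha : R) :
  Hmx R N *m S1mx N alpha = S1mx N alpha *m Hmx R N.
Proof.
rewrite /Hmx mul_diag_mx mul_mx_diag; apply/matrixP => k l; rewrite !mxE.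
rewrite [RHS]mulrC !sgr_half.
have [->//|ne] := eqVneq (0 <= idx k) (0 <= idx l).
(* The signs differ, so the entry of S1 itself must vanish. *)
suff -> : (if idx l == idx k - 1 then (idx k)%:~R
      else if idx l == idx k then (2 * idx k + 1)%:~R
      else if idx l == idx k + 1 then (idx k + 1)%:~R
      else 0) = 0 :> R[i]%C by rewrite !mulr0.
case: eqP => [e|_].
  by have -> : idx k = 0 by lia.
case: eqP => [e|_]; first by rewrite e eqxx in ne.
case: eqP => [e|//].
by have -> : idx k + 1 = 0 by lia.
Qed.

Lemma adjmx_HS1 {R : realType} {N : nat} (alpha : R) :
  adjmx (Hmx R N *m S1mx N alpha) = Hmx R N *m S1mx N alpha.
Proof.
rewrite adjmxM adjmx_S1mx adjmx_Hmx Hmx_S1mxC.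
by move: (Hmx R N) (S1mx N alpha) => H S; rewrite mulNmx mulmxN opprK.
Qed.

Lemma adjmx_HS2 {R : realType} {N : nat} (alpha : R) :
  adjmx (Hmx R N *m S2mx N alpha) = - (Hmx R N *m S2mx N alpha).
Proof.
rewrite /S2mx !adjmxM adjmx_S1mx adjmx_Hmx.
move: (Hmx_S1mxC (N := N) alpha).
move: (Hmx R N) (S1mx N alpha) => H S HS.
by rewrite !(mulNmx, mulmxN) opprK -mulmxA -HS !mulmxA HS.
Qed.

(** * Symmetries in physical space *)

Lemma innerh_S1_skew {R : realType} {N : nat} (alpha : R)
    (u v : 'cV[R[i]%C]_N) : 0 < alpha -> (0 < N)%N ->
  innerh alpha (conjPF alpha (S1mx N alpha) *m u) v =
  - innerh alpha u (conjPF alpha (S1mx N alpha) *m v).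
Proof.
move=> a0 N0.
by rewrite (innerh_adjoint _ _ _ _ a0 N0) adjmx_S1mx conjPFN mulNmx innerhNr.
Qed.

Lemma innerh_HS1_sym {R : realType} {N : nat} (alpha : R)
    (u v : 'cV[R[i]%C]_N) : 0 < alpha -> (0 < N)%N ->
  innerh alpha (conjPF alpha (Hmx R N *m S1mx N alpha) *m u) v =
  innerh alpha u (conjPF alpha (Hmx R N *m S1mx N alpha) *m v).
Proof.
move=> a0 N0.
by rewrite (innerh_adjoint _ _ _ _ a0 N0) adjmx_HS1.
Qed.

Lemma innerh_HS2_skew {R : realType} {N : nat} (alpha : R)
    (u v : 'cV[R[i]%C]_N) : 0 < alpha -> (0 < N)%N ->
  innerh alpha (conjPF alpha (Hmx R N *m S2mx N alpha) *m u) v =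
  - innerh alpha u (conjPF alpha (Hmx R N *m S2mx N alpha) *m v).
Proof.
move=> a0 N0.
by rewrite (innerh_adjoint _ _ _ _ a0 N0) adjmx_HS2 conjPFN mulNmx innerhNr.
Qed.

Lemma innerh_diag_real {R : realType} {N : nat} (alpha : R) (a : 'cV[R]_N)
    (u v : 'cV[R[i]%C]_N) :
  innerh alpha (diag_mx (cvec a)^T *m u) v =
  innerh alpha u (diag_mx (cvec a)^T *m v).
Proof.
rewrite !innerhE; apply: eq_bigr => j _; congr (_ * _).
by rewrite !mul_diag_mx !mxE conjcM conjc_real; ring.
Qed.

Lemma innerh_realC {R : realType} {N : nat} (alpha : R) (a b : 'cV[R]_N) :
  innerh alpha (cvec a) (cvec b) = innerh alpha (cvec b) (cvec a).
Proof.
rewrite !innerhE; apply: eq_bigr => j _; congr (_ * _).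
by rewrite !mxE !conjc_real mulrC.
Qed.

Lemma powv_cvec {R : realType} {N : nat} (u : 'cV[R]_N) (p : nat) :
  powv (cvec u) p = cvec (map_mx (fun x => x ^+ p) u).
Proof. by apply/matrixP => i j; rewrite !mxE rmorphXn. Qed.

Lemma powvS {R : realType} {N : nat} (u : 'cV[R[i]%C]_N) (p : nat) :
  powv u p.+1 = diag_mx (powv u p)^T *m u.
Proof.
by rewrite mul_diag_mx; apply/matrixP => i j; rewrite ord1 !mxE exprSr.
Qed.

Lemma has_vderiv_cvec {R : realType} {N : nat} (I : interval R)
    (u : R -> 'cV[R]_N) t (du : 'cV[R]_N) :
  (forall j, has_deriv I (fun s => u s j ord0) t (du j ord0)) ->
  has_vderiv I (fun s => cvec (u s)) t (cvec du).
Proof.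
move=> duP j; under eq_fun do rewrite mxE.
by rewrite mxE; exact: has_cderiv_real.
Qed.

Lemma has_vderiv_powv {R : realType} {N : nat} (I : interval R)
    (v : R -> 'cV[R[i]%C]_N) t dv m :
  has_vderiv I v t dv ->
  has_vderiv I (fun s => powv (v s) m) t
    (m%:R *: (diag_mx (powv (v t) m.-1)^T *m dv)).
Proof.
move=> dvP j; under eq_fun do rewrite mxE.
rewrite mul_diag_mx !mxE mulrA; exact: has_cderivX.
Qed.

(** * Conservation laws *)

(** The solution is driven by a skew-adjoint operator applied to the gradient g
    of the energy. *)
Lemma energy_conserved {R : realType} {N : nat} (alpha : R) m (I : interval R)
    (u : R -> 'cV[R]_N) : 0 < alpha -> (0 < N)%N -> (0 < m)%N ->
  real_solution (rhs_energy m alpha) I u ->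
  forall t, t \in I -> has_cderiv I (fun s => Eh m alpha (cvec (u s))) t 0.
Proof.
move=> a0 N0 m0 sol t /sol[_ [du [/has_vderiv_cvec dU eqn]]].
set U := fun s => cvec (u s) in dU *; set dv := cvec du in dU eqn.
set A := conjPF alpha (Hmx R N *m S1mx N alpha).
have dA := has_cderiv_innerh alpha _ _ _ _ _ _
  (has_vderiv_mulmx _ _ _ _ A dU) dU.
have dP := has_cderiv_innerh alpha _ _ _ _ _ _
  (has_vderiv_powv _ _ _ _ m dU) dU.
have dE := has_cderivD _ _ _ _ _ _
  (has_cderivM _ _ _ _ _ _ (has_cderiv_cst I 2^-1 t) dA)
  (has_cderivM _ _ _ _ _ _ (has_cderiv_cst I (- (m * m.+1)%N%:R^-1) t) dP).
move: dE; congr has_cderiv.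
  by apply/funext => s; rewrite /Eh mulNr.
(* By reality both halves of the derivative of <u^m, u> are multiples of
   <u^m, u'>, with coefficients m and 1. *)
rewrite !mul0r !add0r innerhZl powv_cvec innerh_diag_real -powv_cvec -powvS.
rewrite prednK//.
have qC : innerh alpha dv (powv (U t) m) = innerh alpha (powv (U t) m) dv.
  by rewrite /U powv_cvec innerh_realC.
set g := A *m U t - m%:R^-1 *: powv (U t) m.
have dvE : dv = conjPF alpha (S1mx N alpha) *m g.
  by rewrite eqn /rhs_energy -mulmxN opprD opprK.
have skew : innerh alpha g dv + innerh alpha dv g = 0.
  by rewrite dvE (innerh_S1_skew _ _ _ a0 N0) subrr.
have gl : innerh alpha g dv =
    innerh alpha (A *m U t) dv - m%:R^-1 * innerh alpha (powv (U t) m) dv.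
  by rewrite innerhDl innerhNl innerhZl.
have gr : innerh alpha dv g =
    innerh alpha dv (A *m U t) - m%:R^-1 * innerh alpha (powv (U t) m) dv.
  rewrite -innerhC gl conjcB [(m%:R^-1 * _)^*%C]conjcM !innerhC.
  by rewrite conjc_inv conjc_nat qC.
rewrite /A (innerh_HS1_sym _ _ _ a0 N0) -/A -/(U t) qC.
rewrite gl gr in skew; move: skew.
set q := innerh _ (powv _ _) _; set p := innerh _ (A *m _) _.
set p' := innerh _ dv (A *m _) => skew.
have m1 : m%:R != 0 :> R[i]%C by rewrite pnatr_eq0 -lt0n.
have m2 : m.+1%:R != 0 :> R[i]%C by rewrite pnatr_eq0.
(* Skewness says p + p' = 2 q / m, and m + 1 cancels in m + 1 over m (m + 1). *)
have -> : p' = 2 * m%:R^-1 * q - p.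
  by apply/eqP; rewrite -subr_eq0 -skew; apply/eqP; ring.
by rewrite natrM -natr1 in m2 *; field; rewrite m1 m2.
Qed.

(** The two discrete forms of the nonlinearity contribute the real part of
    <D u, u^m> with opposite signs, so giving them equal weights cancels it. *)
Lemma mass_conserved {R : realType} {N : nat} (alpha : R) m (I : interval R)
    (u : R -> 'cV[R]_N) : 0 < alpha -> (0 < N)%N -> (0 < m)%N ->
  real_solution (rhs_mass m alpha) I u ->
  forall t, t \in I -> has_cderiv I (fun s => Mh alpha (cvec (u s))) t 0.
Proof.
move=> a0 N0 m0 sol t /sol[_ [du [/has_vderiv_cvec dU eqn]]].
(* With c real, e imaginary and b conjugate to a, e - c (a - b) is imaginary. *)
have alg (c e a b : R[i]%C) : c^*%C = c -> e^*%C = - e -> a^*%C = b ->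
    b^*%C = a -> (e - c * (a - b)) + (e - c * (a - b))^*%C = 0.
  by move=> cJ eJ aJ bJ; rewrite conjcB conjcM conjcB cJ eJ aJ bJ; ring.
have := has_cderiv_innerh alpha _ _ _ _ _ _ dU dU.
congr has_cderiv; rewrite -[innerh _ (cvec (u t)) _]innerhC.
set U := cvec (u t) in eqn *; rewrite eqn /rhs_mass.
set B := conjPF _ _; set D := conjPF _ (S1mx _ _); set c := m.+1%:R^-1.
have e1 : innerh alpha (diag_mx (powv U m.-1)^T *m (D *m U)) U =
    innerh alpha (D *m U) (powv U m).
  by rewrite powv_cvec innerh_diag_real -powv_cvec -powvS prednK.
have e2 : innerh alpha (D *m powv U m) U = - innerh alpha (powv U m) (D *m U).
  exact: innerh_S1_skew.
have cJ : c^*%C = c by rewrite /c conjc_inv conjc_nat.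
have -> : innerh alpha (B *m U - c *: (diag_mx (powv U m.-1)^T *m (D *m U)
      + D *m powv U m)) U = innerh alpha (B *m U) U
      - c * (innerh alpha (D *m U) (powv U m) - innerh alpha (powv U m) (D *m U)).
  by rewrite innerhDl innerhNl innerhZl innerhDl e1 e2.
have eJ : (innerh alpha (B *m U) U)^*%C = - innerh alpha (B *m U) U.
  by rewrite innerhC (innerh_HS2_skew _ _ _ a0 N0) opprK.
have aJ := innerhC alpha (D *m U) (powv U m).
have bJ := innerhC alpha (powv U m) (D *m U).
exact: alg.
Qed.

Theorem proposition2p1 (R : realType) (alpha : R) (N m : nat)
    (halpha : 0 < alpha) (hN0 : (0 < N)%N) (hNeven : ~~ odd N)
    (hm : (1 <= m)%N) :
  (forall (I : interval R) (u : R -> 'cV[R]_N),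
     real_solution (rhs_energy m alpha) I u ->
     forall t : R, t \in I ->
       has_cderiv I (fun s => Eh m alpha (cvec (u s))) t 0) /\
  (forall (I : interval R) (u : R -> 'cV[R]_N),
     real_solution (rhs_mass m alpha) I u ->
     forall t : R, t \in I ->
       has_cderiv I (fun s => Mh alpha (cvec (u s))) t 0).
Proof.
split=> I u sol t It.
  exact: energy_conserved hN0 hm sol t It.
exact: mass_conserved hN0 hm sol t It.
Qed.
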